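(* For every integer $i\ge 3$, there is no sequence of generalized action graphs for the $i$-th diagonal of Catalan's triangle, i.e. for the sequence $\{s_k\}_{k\ge0}$ with $s_k = C(i+k,k)$.
   Context: Catalan's triangle has entries $C(n,k)=\frac{n-k+1}{n+1}\binom{n+k}{k}$ for integers $n\ge k\ge 0$. Generalized action graphs. Let $\{s_n\}_{n\ge0}$ be a sequence of positive integers. A sequence of generalized action graphs for $\{s_n\}$ is a sequence $\{G_n\}_{n\ge 0}$ of directed graphs whose vertices are labeled by non-negative integers such that: (Axiom 1) $G_0$ is the graph with $s_0$ vertices labeled $0$ and no edges. For $n\ge1$, $G_n$ is constructed from $G_{n-1}$ by adding $s_n$ new vertices, each labeled $n$; each new vertex is attached by exactly one new edge, directed from some vertex of $G_{n-1}$ to the new vertex, and no other edges are added (so each connected component is a directed tree rooted at a vertex labeled $0$). (Axiom 2) For every $n$ and every vertex $v$ of $G_n$, the subtree of $G_n$ with root $v$ is isomorphic to $G_k$ for some $k\le n$. Here the subtree with root $v$ is the induced subgraph on $v$ and its descendants (the vertices $w$ for which there is a directed path from $v$ to $w$), and isomorphisms are isomorphisms of directed graphs respecting labels up to adding one constant to all labels. (Axiom 3) Every leaf of $G_n$ (vertex with no outgoing edge) has label $n$. *)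

(* Defs.v *)
From mathcomp Require Import all_boot all_order all_algebra.

Set Implicit Arguments.
Unset Strict Implicit.
Unset Printing Implicit Defensive.

(* The division is exact for k <= n, see catalan_triangle_exact. *)
Definition catalan_triangle (n k : nat) : nat :=
  ((n - k + 1) * 'C(n + k, k)) %/ (n + 1).

Lemma catalan_triangle_exact (n k : nat) :
  k <= n -> catalan_triangle n k * (n + 1) = (n - k + 1) * 'C(n + k, k).
Proof.
move=> le_kn; apply: divnK; case: k le_kn => [|k] le_kn.
  by rewrite subn0 dvdn_mulr.
have E : k.+1 * 'C(n + k.+1, k.+1) = (n + 1) * 'C(n + k.+1, k).
  by rewrite mul_bin_left -addSnnS addnK addn1.
have -> : n - k.+1 + 1 = n + 1 - k.+1 by rewrite addnBAC.
by rewrite mulnBl E -mulnBr dvdn_mulr.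
Qed.

Lemma catalan_triangle_gt0 (n k : nat) : k <= n -> 0 < catalan_triangle n k.
Proof.
move=> le_kn; have := catalan_triangle_exact le_kn.
case: (catalan_triangle n k) => // /esym/eqP.
by rewrite mul0n muln_eq0 addn1 /= eqn0Ngt bin_gt0 leq_addl.
Qed.

Record lgraph := LGraph {
  vertex :> finType;
  edge : rel vertex;
  label : vertex -> nat
}.

(* The shift c ranges over int, so that the relation is symmetric. *)
Definition isomorphic (G H : lgraph) : Prop :=
  exists f : G -> H,
    [/\ bijective f,
        forall u v : G, edge (f u) (f v) = edge u v
      & exists c : int, forall v : G,
          (Posz (label (f v)) = Posz (label v) + c)%R].

Definition subtree (G : lgraph) (v : G) : lgraph :=
  @LGraph {w : G | connect (@edge G) v w}
    (fun x y => edge (val x) (val y)) (fun x => label (val x)).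

Definition leaf (G : lgraph) (v : G) : Prop := forall w : G, ~~ edge v w.

Definition initial (m : nat) (G : lgraph) : Prop :=
  [/\ #|G| = m,
      forall v : G, label v = 0
    & forall u v : G, ~~ edge u v].

(* G is identified with its image under f, the new vertices being those
   outside the image. *)
Definition extends (n m : nat) (G H : lgraph) : Prop :=
  exists f : G -> H,
    [/\ injective f,
        forall v : G, label (f v) = label v,
        forall u v : G, edge (f u) (f v) = edge u v,
        #|[set w : H | w \notin codom f]| = m
      & forall w : H, w \notin codom f ->
          [/\ label w = n,
              exists v : G, forall u : H, edge u w = (u == f v)
            & forall u : H, ~~ edge w u]].

Record generalized_action_graphs (s : nat -> nat) (G : nat -> lgraph) : Prop :=
  GeneralizedActionGraphs {
    gag_initial : initial (s 0) (G 0);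
    gag_extends : forall n, extends n.+1 (s n.+1) (G n) (G n.+1);
    gag_subtree : forall n (v : G n),
      exists2 k, k <= n & isomorphic (subtree v) (G k);
    gag_leaf : forall n (v : G n), leaf v -> label v = n
  }.

(* Main.v *)
Require Import Defs.
From mathcomp Require Import all_boot all_order all_algebra.
From mathcomp Require Import zify.

(** In [G 2] a vertex [v] labeled 1 is not a leaf, and the vertices of its
    subtree other than [v] are children of [v].  By Axiom 2 the subtree is
    therefore a copy of [G 1], so [v] has [s 1] children.  There are [s 1] such
    [v], and no vertex has two parents, so [s 1 ^ 2 <= s 2].  On the [i]-th
    diagonal, [s 1 = i + 1] and [s 2 = (i + 1) (i + 4) / 2], which contradicts
    this inequality as soon as [i >= 3]. *)

Lemma extends_card n m (G H : lgraph) : extends n m G H -> #|H| = #|G| + m.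
Proof.
case=> f [injf _ _ <- _]; rewrite -(card_codom injf) -(cardC [in codom f]).
by congr (_ + _); apply: eq_card => w; rewrite !inE.
Qed.

Lemma isomorphic_card (G H : lgraph) : isomorphic G H -> #|G| = #|H|.
Proof. by case=> f [bijf _ _]; apply: bij_eq_card bijf. Qed.

Lemma subtree_card (G : lgraph) (v : G) :
  #|subtree v| = #|[set w : G | connect (@edge G) v w]|.
Proof. by rewrite /= card_sig; apply: eq_card => w; rewrite !inE. Qed.

Lemma connect_star (T : finType) (e : rel T) (v w : T) :
  (forall x y, e v x -> ~~ e x y) -> connect e v w -> w = v \/ e v w.
Proof.
move=> out0 /connectP[[|x [|y p]] /=]; first by move=> _; left.
  by rewrite andbT => evx ->; right.
by case/and3P=> evx exy; case/negP: (out0 x y evx).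
Qed.

(** Double counting: once the two sums are exchanged, each [y] in [B] contributes at most 1, having
    at most one in-neighbor. *)
Lemma sum_card_out_neighbors (S T : finType) (A : {set S}) (B : {set T})
    (e : S -> T -> bool) :
    (forall x y, x \in A -> e x y -> y \in B) ->
    (forall x x' y, y \in B -> e x y -> e x' y -> x = x') ->
  \sum_(x in A) #|[set y | e x y]| <= #|B|.
Proof.
move=> eB e_inj.
have -> : \sum_(x in A) #|[set y | e x y]|
          = \sum_(x in A) \sum_(y in B) (e x y : nat).
  apply: eq_bigr => x Ax; rewrite -sum1_card big_mkcond [RHS]big_mkcond /=.
  apply: eq_bigr => y _; rewrite inE; case exy: (e x y); last by case: ifP.
  by rewrite (eB x y Ax exy).
rewrite exchange_big /= -[leqRHS]sum1_card; apply: leq_sum => y By.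
have [/existsP[x exy] | /existsPn no_x] := boolP [exists x, e x y]; last first.
  by rewrite big1 // => x _; rewrite (negPf (no_x x)).
rewrite big_mkcond (bigD1 x) //= big1 ?addn0 => [|x' /negP neq_x'].
  by case: ifP => _ //; case: (e x y).
case: ifP => // _; case ex'y: (e x' y) => //.
by case: neq_x'; apply/eqP; apply: e_inj By ex'y exy.
Qed.

Lemma gag_sqr_leq (s : nat -> nat) (G : nat -> lgraph) :
  generalized_action_graphs s G -> s 0 = 1 -> s 1 ^ 2 <= s 2.
Proof.
case=> [[card0 _ noedge0] ext sub leafP] s0.
have card1 := extends_card _ _ _ _ (ext 0).
have [g [_ _ _ cardN1 N1P]] := ext 0.
have [f [injf labf edgef cardN2 N2P]] := ext 1.
set N1 := [set _ | _] in cardN1; set N2 := [set _ | _] in cardN2.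
(* An edge from [f v] to an old vertex would come from an edge out of [v] in [G 1], where [v] is new
   and has none. *)
have child_new v w : v \in N1 -> edge (f v) w -> w \in N2.
  rewrite !inE => /N1P[_ _ out0] evw; apply/negP => /codomP[u wE].
  by move: evw; rewrite wE edgef; apply/negP.
have star v w : v \in N1 -> connect (@edge (G 2)) (f v) w ->
    w = f v \/ edge (f v) w.
  move=> Nv; apply: connect_star => x y /(child_new _ _ Nv).
  by rewrite inE => /N2P[_ _]; apply.
have card_children v : v \in N1 -> s 1 <= #|[set w | edge (f v) w]|.
  move=> Nv; have [k le_k2 iso] := sub 2 (f v).
  have cardT := isomorphic_card _ _ iso.
  have le_card : #|subtree (f v)| <= #|[set w | edge (f v) w]|.+1.
    rewrite subtree_card; set C := [set w | edge _ w].
    apply: (@leq_trans #|f v |: C|).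
      apply/subset_leq_card/subsetP => w.
      by rewrite !inE => /(star _ _ Nv)[-> | ->]; rewrite ?eqxx ?orbT.
    by rewrite cardsU1; case: (_ \notin _).
  case: k le_k2 iso cardT => [|[|[|//]]] _ iso cardT.
  (* Case [k = 0]: [f v] has label 1 in [G 2], so it is not a leaf, whereas [G 0] has no edges. *)
  - have /existsP[w evw] : [exists w, edge (f v) w].
      apply: contraT => /existsPn /(leafP 2).
      by move: Nv; rewrite labf inE => /N1P[->].
    case: iso => h [_ edgeh _].
    have := noedge0 (h (exist _ (f v) (connect0 _ _)))
                    (h (exist _ w (connect1 evw))).
    by rewrite edgeh /= evw.
  (* Case [k = 1]: [G 1] has [1 + s 1] vertices, so [le_card] gives the bound. *)
  - by move: le_card; rewrite cardT card1 card0 s0.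
  (* Case [k = 2]: the subtree misses the root [f (g r)], so it is too small to be a copy of
     [G 2]. *)
  - have /card_gt0P[r _] : 0 < #|G 0| by rewrite card0 s0.
    suff : #|subtree (f v)| < #|G 2| by rewrite cardT ltnn.
    rewrite subtree_card -cardsT; apply/proper_card/properP.
    split; first exact: subsetT.
    exists (f (g r)); rewrite ?inE //; apply/negP.
    case/(star _ _ Nv) => [/injf vE | /(child_new _ _ Nv)].
      by move: Nv; rewrite inE -vE codom_f.
    by rewrite inE codom_f.
have le_sum : \sum_(v in N1) #|[set w | edge (f v) w]| <= #|N2|.
  apply: sum_card_out_neighbors child_new _ => v v' w.
  rewrite inE => /N2P[_ [u uP] _].
  by rewrite !uP => /eqP/injf-> /eqP/injf->.
rewrite -cardN2; apply: leq_trans le_sum.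
by rewrite -mulnn -{1}cardN1 -sum_nat_const; apply: leq_sum.
Qed.

Lemma catalan_triangle0 n : catalan_triangle n 0 = 1.
Proof. by rewrite /catalan_triangle subn0 bin0 muln1 divnn addn1. Qed.

Lemma catalan_triangle1 n : catalan_triangle (n + 1) 1 = n + 1.
Proof.
apply/eqP; rewrite -(eqn_pmul2r (m := n + 1 + 1)); last by rewrite addn1.
by rewrite catalan_triangle_exact ?leq_addl // addnK bin1.
Qed.

Lemma catalan_triangle2 n : catalan_triangle (n + 2) 2 * 2 = (n + 1) * (n + 4).
Proof.
have triE := catalan_triangle_exact (leq_addl n 2).
have := bin_ffact (n + 2 + 2) 2; rewrite addnK in triE *.
(* Twice the binomial is [(n + 4) * (n + 3)], and the factor [n + 3] cancels against the
   denominator. *)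
rewrite ffactnS ffactn1 -[2`!]/2 => bin2E; nia.
Qed.

Theorem proposition3p7 (i : nat) (hi : 3 <= i) :
  ~ exists G : nat -> lgraph,
      generalized_action_graphs (fun k => catalan_triangle (i + k) k) G.
Proof.
case=> G /gag_sqr_leq /(_ (catalan_triangle0 _)).
(* Doubling the inequality and cancelling [i + 1] leaves [2 * (i + 1) <= i + 4], that is
   [i <= 2]. *)
rewrite catalan_triangle1; have := catalan_triangle2 i; nia.
Qed.
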